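(* Let $G$ and $Q$ be two groups. Let $\Sigma$ be the set of all surjective homomorphisms from $G$ onto $Q$, let $\mathcal{T}=\Sigma/\!\sim_c$ be the set of equivalence classes of $\Sigma$ under the conjugacy relation $\sim_c$, and let $\Lambda\subseteq\Sigma$ be a set of representatives of $\mathcal{T}$. Let $\lambda\in\Lambda$ be such that for every $\omega\in\Lambda$ for which $\mathrm{Ker}(\omega)$ is isomorphic to $\mathrm{Ker}(\lambda)$ one has $\mathrm{Ker}(\lambda)=\mathrm{Ker}(\omega)$. Then $\mathrm{Ker}(\lambda)$ is a characteristic subgroup of $G$.
   Context: Two homomorphisms $\psi_1,\psi_2\colon G\to H$ are conjugate, written $\psi_1\sim_c\psi_2$, if there is $h\in H$ with $\psi_2(g)=h\psi_1(g)h^{-1}$ for all $g\in G$; this is an equivalence relation. A subgroup $K$ of $G$ is characteristic if $\varphi(K)=K$ for every automorphism $\varphi$ of $G$. *)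

(* Defs.v *)
From HB Require Import structures.
From mathcomp Require Import all_boot.
From mathcomp Require Import boolp classical_sets functions.

Set Implicit Arguments.
Unset Strict Implicit.
Unset Printing Implicit Defensive.

Local Open Scope classical_set_scope.
Local Open Scope group_scope.

(* [groupType] is the structure of arbitrary, possibly infinite, groups. Its
   morphisms [{multiplicative G -> H}] are only required to preserve products;
   between groups, units and inverses are then preserved as well. *)

Definition isomorphic (G H : groupType) : Prop :=
  exists f : {multiplicative G -> H}, bijective f.

Definition conjugate (G H : groupType) (psi1 psi2 : {multiplicative G -> H}) :
    Prop :=
  exists h : H, forall g : G, psi2 g = h * psi1 g * h^-1.

Definition epimorphisms (G H : groupType) : set {multiplicative G -> H} :=
  [set psi | set_surj [set: G] [set: H] psi].
Arguments epimorphisms : clear implicits.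

Definition conj_class (G H : groupType) (S : set {multiplicative G -> H})
    (psi : {multiplicative G -> H}) : set {multiplicative G -> H} :=
  [set omega | S omega /\ conjugate psi omega].

Definition conj_classes (G H : groupType) (S : set {multiplicative G -> H}) :
    set (set {multiplicative G -> H}) :=
  [set conj_class S psi | psi in S].

Definition representatives (T : Type) (P : set (set T)) (L : set T) : Prop :=
  forall C, P C -> exists! x, L x /\ C x.

Definition ker (G H : groupType) (f : {multiplicative G -> H}) : set G :=
  [set x | f x = 1].

Lemma ker_group_closed (G H : groupType) (f : {multiplicative G -> H}) :
  group_closed (mem (ker f)).
Proof.
have f1 : f 1 = 1 by apply: (mulgI (f 1)); rewrite -gmulfM !mulg1.
split=> [|x y]; rewrite !inE /ker /=; first exact: f1.
move=> fx fy; rewrite gmulfM fx mul1g.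
by apply: (mulIg (f y)); rewrite -gmulfM mulVg f1 mul1g.
Qed.

(* The kernel as a group in its own right, for the operations induced by G. *)
Definition ker_group (G H : groupType) (f : {multiplicative G -> H}) : Type :=
  {x : G | x \in ker f}.

Section KerGroup.
Variables (G H : groupType) (f : {multiplicative G -> H}).

HB.instance Definition _ := SubChoice.on (ker_group f).
HB.instance Definition _ :=
  SubChoice_isSubGroup.Build G (mem (ker f)) (ker_group f) (ker_group_closed f).

End KerGroup.

Definition characteristic (G : groupType) (K : set G) : Prop :=
  group_closed (mem K) /\
  forall phi : {multiplicative G -> G}, bijective phi -> phi @` K = K.

(* Main.v *)
From HB Require Import structures.
Require Import Defs.
From mathcomp Require Import all_boot.
From mathcomp Require Import boolp classical_sets functions.

Local Open Scope classical_set_scope.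
Local Open Scope group_scope.

(* If [phi] is an automorphism of [G], the representative [omega] of the class
   of [lambda \o phi] has kernel [phi @^-1` ker lambda], since conjugation in
   [Q] does not change kernels. Hence [phi] restricts to an isomorphism from
   [ker omega] onto [ker lambda], and the hypothesis gives
   [ker lambda = phi @^-1` ker lambda]. *)

Lemma ker_conjugate (G H : groupType) (psi1 psi2 : {multiplicative G -> H}) :
  conjugate psi1 psi2 -> ker psi1 = ker psi2.
Proof.
case=> h psiE; apply/seteqP; split=> x; rewrite /ker /= psiE.
  by move=> ->; rewrite mulg1 mulgV.
(* Cancelling [h] and [h^-1] reduces the claim to [h * psi1 x * h^-1 = h * 1 * h^-1]. *)
by move=> psix; apply: (mulgI h); apply: (mulIg h^-1); rewrite psix mulg1 mulgV.
Qed.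

Section KerRestriction.
Variables (G1 G2 H1 H2 : groupType).
Variables (f1 : {multiplicative G1 -> H1}) (f2 : {multiplicative G2 -> H2}).
Variable phi : {multiplicative G1 -> G2}.
Hypothesis ker_phi : ker f1 = phi @^-1` ker f2.

Lemma ker_restr_subproof (x : ker_group f1) : phi (val x) \in ker f2.
Proof. by case: x => x /=; rewrite !inE ker_phi. Qed.

Definition ker_restr (x : ker_group f1) : ker_group f2 :=
  Sub (phi (val x)) (ker_restr_subproof x).

Lemma ker_restrM : {morph ker_restr : x y / x * y}.
Proof. by move=> x y; apply: val_inj; rewrite /= gmulfM. Qed.

HB.instance Definition _ :=
  isMultiplicative.Build (ker_group f1) (ker_group f2) ker_restr ker_restrM.

(** Since [ker_phi] is an equality, the inverse of [phi] also maps kernel to kernel, and its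
    restriction inverts [ker_restr]. *)
Lemma ker_isomorphic : bijective phi -> isomorphic (ker_group f1) (ker_group f2).
Proof.
case=> psi phiK psiK; exists ker_restr.
have psi_ker (y : ker_group f2) : psi (val y) \in ker f1.
  by case: y => y /=; rewrite !inE ker_phi /= psiK.
exists (fun y => Sub (psi (val y)) (psi_ker y)) => x; apply: val_inj => /=.
  exact: phiK.
exact: psiK.
Qed.

End KerRestriction.

Lemma epimorphism_comp (G1 G2 H : groupType) (f : {multiplicative G2 -> H})
    (phi : {multiplicative G1 -> G2}) :
  epimorphisms G2 H f -> bijective phi -> epimorphisms G1 H (f \o phi).
Proof.
move=> f_surj [psi _ psiK] y /f_surj [x _ <-].
by exists (psi x) => //=; rewrite psiK.
Qed.

Theorem theorem1 (G Q : groupType)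
    (Lambda : set {multiplicative G -> Q})
    (Lambda_sub : Lambda `<=` epimorphisms G Q)
    (Lambda_rep : representatives (conj_classes (epimorphisms G Q)) Lambda)
    (lambda : {multiplicative G -> Q})
    (lambda_in : Lambda lambda)
    (lambda_ker : forall omega : {multiplicative G -> Q}, Lambda omega ->
       isomorphic (ker_group omega) (ker_group lambda) ->
       ker lambda = ker omega) :
  characteristic (ker lambda).
Proof.
split=> [|phi phi_bij]; first exact: ker_group_closed.
have psi_epi := epimorphism_comp _ _ _ _ _ (Lambda_sub _ lambda_in) phi_bij.
have [|omega [[Lomega [_ /(ker_conjugate _ _ _ _) ker_omega]] _]] :=
  Lambda_rep (conj_class (epimorphisms G Q) (lambda \o phi)).
  (* By [psi_epi], [lambda \o phi] is an epimorphism, so its class is one of those represented in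
     [Lambda]. *)
  by exists (lambda \o phi).
have ker_phi : ker omega = phi @^-1` ker lambda by rewrite -ker_omega.
have kerE : ker lambda = phi @^-1` ker lambda.
  by rewrite -ker_phi; apply: lambda_ker => //; exact: ker_isomorphic ker_phi phi_bij.
(* Rewriting only the [ker lambda] under the image gives the image of a preimage, which collapses
   once [phi] is shown to be surjective. *)
rewrite {1}kerE image_preimage //; apply/seteqP; split=> // y _.
by case: phi_bij => psi _ psiK; exists (psi y); rewrite ?psiK.
Qed.
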